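(* Let $d\ge1$, $s\in\{1,\dots,d\}$, and let data $(\mathbf x^{(i)},y_i)$, $1\le i\le n$, be given with $\mathbf x^{(i)}\in[0,1]^d$ and $y_i\in\mathbb{R}$. Then a least squares estimator $$\hat f^{d,s}_{\mathrm{TC}}\in\operatorname*{argmin}_{f\in\mathcal{F}^{d,s}_{\mathrm{TC}}}\sum_{i=1}^n\big(y_i-f(\mathbf x^{(i)})\big)^2$$ exists, and it can be computed as the least squares minimizer over the class of all functions on $[0,1]^d$ of the form $$\beta_0+\sum_{S:1\le|S|\le s}\beta_S\Big[\prod_{j\in S}x_j\Big]-\sum_{S:1\le|S|\le s}\ \sum_{\mathbf t=(t_j,j\in S)\in L_S}\beta^{(\mathbf t)}\Big[\prod_{j\in S}(x_j-t_j)_+\Big],$$ where $\beta_0,\beta_S$ ($1\le|S|\le s$) are real numbers and $\beta^{(\mathbf t)}$, $\mathbf t\in L_S$, are nonnegative real numbers (one for each $S$ and each $\mathbf t\in L_S$). That is, the minimum of $\sum_{i=1}^n(y_i-f(\mathbf x^{(i)}))^2$ over this latter class is attained, and every minimizer over this class is a minimizer over $\mathcal{F}^{d,s}_{\mathrm{TC}}$.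
   Context: $[d]=\{1,\dots,d\}$, $\mathbf 0=(0,\dots,0)$, $(x)_+=\max(x,0)$; $S$ ranges over subsets of $[d]$. $\mathcal{F}^{d,s}_{\mathrm{TC}}$ is the class of all functions $f:[0,1]^d\to\mathbb{R}$ of the form $$f(x_1,\dots,x_d)=\beta_0+\sum_{S:1\le|S|\le s}\beta_S\prod_{j\in S}x_j-\sum_{S:1\le|S|\le s}\int_{[0,1)^{|S|}\setminus\{\mathbf 0\}}\prod_{j\in S}(x_j-t_j)_+\,d\nu_S(t_j,j\in S),$$ where $\beta_0,\beta_S\in\mathbb{R}$ and each $\nu_S$ is a finite (nonnegative) Borel measure on $[0,1)^{|S|}\setminus\{\mathbf 0\}$. For $S\subseteq[d]$ with $1\le|S|\le s$, the lattice $L_S$ generated by the data is $$L_S=\prod_{j\in S}\Big(\{0\}\cup\{x^{(i)}_j:i=1,\dots,n\}\Big)\setminus\{\mathbf 0\},$$ where $x^{(i)}_j$ is the $j$-th coordinate of $\mathbf x^{(i)}$. *)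

(* Defs.v *)
From HB Require Import structures.
From mathcomp Require Import all_boot all_order all_algebra.
From mathcomp Require Import all_classical all_reals all_analysis.
Set Implicit Arguments. Unset Strict Implicit. Unset Printing Implicit Defensive.
Import Order.TTheory GRing.Theory Num.Theory.
Import numFieldNormedType.Exports.
Local Open Scope classical_set_scope.
Local Open Scope ring_scope.

Definition cube (R : realType) (d : nat) : set (d.-tuple R) :=
  [set x | forall j : 'I_d, 0 <= tnth x j <= 1].
Arguments cube : clear implicits.

Definition origin (R : realType) (k : nat) : k.-tuple R := [tuple 0 | _ < k].
Arguments origin : clear implicits.

Definition knot_domain (R : realType) (k : nat) : set (k.-tuple R) :=
  [set t | forall i : 'I_k, 0 <= tnth t i < 1] `\ origin R k.
Arguments knot_domain : clear implicits.

Definition monomial (R : realType) (d : nat) (S : {set 'I_d})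
    (x : d.-tuple R) : R :=
  \prod_(j in S) tnth x j.

(* A vector (t_j, j in S) is stored as a #|S|-tuple: its i-th entry is the
   coordinate t_j for j = enum_val i, the i-th element of S. *)
Definition hinge (R : realType) (d : nat) (S : {set 'I_d})
    (t : #|S|.-tuple R) (x : d.-tuple R) : R :=
  \prod_(i < #|S|) Num.max (tnth x (enum_val i) - tnth t i) 0.

(* [\int] is real-valued here: the integrand is bounded on the domain and [nu S]
   is finite, so it is always integrable.
   [nu S] is given on all of R^|S|, with its Borel sigma-algebra, but only its
   restriction to [knot_domain R #|S|] matters. A member of the class is
   constrained on the unit cube only; its values elsewhere are irrelevant. *)
Definition F_TC (R : realType) (d s : nat) : set (d.-tuple R -> R) :=
  [set f | exists (beta0 : R) (beta : {set 'I_d} -> R)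
      (nu : forall S : {set 'I_d},
        {finite_measure set (#|S|.-tuple (measurableTypeR R)) -> \bar R}),
    forall x, cube R d x ->
      f x = beta0
        + \sum_(S : {set 'I_d} | (1 <= #|S| <= s)%N) beta S * monomial S x
        - \sum_(S : {set 'I_d} | (1 <= #|S| <= s)%N)
            \int[nu S]_(t in knot_domain R #|S|) hinge t x].
Arguments F_TC : clear implicits.

(* A finite set, so the finitely-supported sum over it in [F_lattice] is a
   genuine sum. *)
Definition lattice (R : realType) (d n : nat) (X : 'I_n -> d.-tuple R)
    (S : {set 'I_d}) : set (#|S|.-tuple R) :=
  [set t | forall i : 'I_#|S|,
     tnth t i = 0 \/ exists m : 'I_n, tnth t i = tnth (X m) (enum_val i)]
  `\ origin R #|S|.
Arguments lattice {R d n} X S.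

Definition F_lattice (R : realType) (d s n : nat) (X : 'I_n -> d.-tuple R) :
    set (d.-tuple R -> R) :=
  [set f | exists (beta0 : R) (beta : {set 'I_d} -> R)
      (gamma : forall S : {set 'I_d}, #|S|.-tuple R -> R),
    (forall S : {set 'I_d}, (1 <= #|S| <= s)%N ->
      forall t, lattice X S t -> 0 <= gamma S t) /\
    forall x, cube R d x ->
      f x = beta0
        + \sum_(S : {set 'I_d} | (1 <= #|S| <= s)%N) beta S * monomial S x
        - \sum_(S : {set 'I_d} | (1 <= #|S| <= s)%N)
            \sum_(t \in lattice X S) gamma S t * hinge t x].
Arguments F_lattice {R d} s {n} X.

Definition rss (R : realType) (d n : nat) (X : 'I_n -> d.-tuple R)
    (y : 'I_n -> R) (f : d.-tuple R -> R) : R :=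
  \sum_(i < n) (y i - f (X i)) ^+ 2.

Definition is_lse (R : realType) (d n : nat) (X : 'I_n -> d.-tuple R)
    (y : 'I_n -> R) (F : set (d.-tuple R -> R)) (f : d.-tuple R -> R) : Prop :=
  F f /\ forall g, F g -> rss X y f <= rss X y g.

(* Main.v *)
(* At a data point x each factor (x_j - t_j)_+ is a function of t_j that is
   replaced by its piecewise linear interpolant at the knots 0 and x^(i)_j,
   without changing its value: t |-> (x - t)_+ is affine between consecutive
   knots when x is itself a knot. Multiplying out and integrating the
   nonnegative interpolation weights turns nu_S into a measure on the lattice;
   the mass reaching the origin only modifies beta_S. Hence both classes have
   the same values at the data, and these form a finitely generated cone.
   The least squares minimum over such a cone is attained: from any feasible
   coefficients one descends, along segments towards the unconstrained minimizer
   on the current face, to a face whose minimizer is feasible, and there are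
   finitely many faces. *)
Require Import Defs.
From HB Require Import structures.
From mathcomp Require Import all_boot all_order all_algebra finmap.
From mathcomp Require Import all_classical all_reals all_analysis.
From mathcomp Require Import measurable_realfun.
From mathcomp Require Import ring lra.
Set Implicit Arguments. Unset Strict Implicit. Unset Printing Implicit Defensive.
Import Order.TTheory GRing.Theory Num.Theory.
Local Open Scope ring_scope.

(** * Least squares with sign constraints *)

(** [v k] is the vector of values of the [k]-th generator at the [n] data points, so fits are linear
    combinations with coefficients [c]. *)
Definition sq_residual (R : realFieldType) n (K : finType)
    (v : K -> 'I_n -> R) (y : 'I_n -> R) (c : K -> R) : R :=
  \sum_(i < n) (y i - \sum_k c k * v k i) ^+ 2.

Section Nnls.
Variables (R : realFieldType) (n : nat).

Lemma mulmx_tr_eq0 (u : 'rV[R]_n) : u *m u^T = 0 -> u = 0.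
Proof.
move=> /matrixP/(_ 0 0); rewrite !mxE => /eqP.
under eq_bigr do rewrite mxE -expr2.
rewrite psumr_eq0 => [|i _]; last exact: sqr_ge0.
move=> /allP u0; apply/rowP => i; rewrite mxE; apply/eqP.
by have := u0 i; rewrite mem_index_enum sqrf_eq0; apply.
Qed.

Lemma normal_equation (m : nat) (A : 'M[R]_(m, n)) (y : 'rV[R]_n) :
  exists c : 'rV_m, (y - c *m A) *m A^T = 0.
Proof.
(* The row space of A meets its orthogonal complement trivially, so together
   they span everything by counting dimensions. *)
have capA0 : (A :&: kermx A^T)%MS = 0.
  apply/eqP; rewrite -submx0; apply/row_subP => i.
  set u := row i _.
  have uA : (u <= A)%MS by rewrite (submx_trans (row_sub _ _)) ?capmxSl.
  have /sub_kermxP uK : (u <= kermx A^T)%MS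
    by rewrite (submx_trans (row_sub _ _)) ?capmxSr.
  have [D uE] := submxP uA.
  by rewrite [u]mulmx_tr_eq0 ?sub0mx// {2}uE trmx_mul mulmxA uK mul0mx.
have fullA : \rank (A + kermx A^T)%MS = n.
  have := mxrank_sum_cap A (kermx A^T).
  rewrite capA0 mxrank0 addn0 mxrank_ker mxrank_tr => ->.
  by rewrite subnKC// rank_leq_col.
have /sub_addsmxP[[u1 u2] yE] : (y <= A + kermx A^T)%MS.
  by apply: submx_full; rewrite /row_full fullA.
exists u1; rewrite {1}yE/= addrC addKr -mulmxA.
by rewrite (_ : kermx A^T *m A^T = 0) ?mulmx0//; apply/sub_kermxP.
Qed.

Variables (K : finType) (v : K -> 'I_n -> R) (y : 'I_n -> R).

Local Notation q := (sq_residual v y).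

(** Generators in [Z] become zero rows of [A], so the normal equation makes the residual orthogonal
    to all the others. For [c'] on the face, the difference [e] of the fits is then orthogonal to
    the residual, and Pythagoras gives [q c' = q c + |e|^2]. *)
Lemma least_squares_face (Z : {set K}) : exists c : K -> R,
  (forall k, k \in Z -> c k = 0) /\
  forall c', (forall k, k \in Z -> c' k = 0) -> q c <= q c'.
Proof.
pose A : 'M[R]_(#|K|, n) :=
  \matrix_(k, i) if enum_val k \in Z then 0 else v (enum_val k) i.
have [c0 c0P] := normal_equation A (\row_i y i).
pose c k := if k \in Z then 0 else c0 0 (enum_rank k).
have ortho k : k \notin Z ->
    \sum_(i < n) (y i - \sum_k' c k' * v k' i) * v k i = 0.
  move=> kZ; have /matrixP/(_ 0 (enum_rank k)) := c0P.
  rewrite !mxE => e; rewrite -[RHS]e; apply: eq_bigr => i _.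
  rewrite !mxE enum_rankK (negbTE kZ); congr ((_ - _) * _).
  rewrite (reindex_onto enum_val enum_rank)/= => [|k' _]; last exact: enum_rankK.
  apply: eq_big => [k'|k' _]; first by rewrite enum_valK eqxx.
  by rewrite mxE /c enum_valK; case: ifP => // _; rewrite mul0r mulr0.
exists c; split=> [k kZ|c' c'Z]; first by rewrite /c kZ.
pose r i := y i - \sum_k c k * v k i.
pose e i := \sum_k (c k - c' k) * v k i.
have re0 : \sum_(i < n) r i * e i = 0.
  under eq_bigr do rewrite mulr_sumr.
  rewrite exchange_big/= big1// => k _.
  have [kZ|kZ] := boolP (k \in Z).
    by rewrite big1// => i _; rewrite /c kZ c'Z// subrr mul0r mulr0.
  by under eq_bigr do rewrite mulrCA; rewrite -mulr_sumr ortho// mulr0.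
have -> : q c' = q c + \sum_(i < n) e i ^+ 2.
  transitivity (\sum_(i < n) (r i ^+ 2 + r i * e i *+ 2 + e i ^+ 2)).
    apply: eq_bigr => i _; rewrite -sqrrD; congr (_ ^+ 2); rewrite /r /e.
    have -> : \sum_k (c k - c' k) * v k i =
        \sum_k c k * v k i - \sum_k c' k * v k i.
      by rewrite -sumrB; apply: eq_bigr => k _; rewrite mulrBl.
    by rewrite addrA subrK.
  by rewrite !big_split/= re0 !addr0.
by rewrite lerDl; apply: sumr_ge0 => i _; exact: sqr_ge0.
Qed.

(** Convexity of [q]: the defect in each summand is [a * (1 - a) * (s - s') ^+ 2]. *)
Lemma sq_residual_segment (a : R) (c c' : K -> R) : 0 <= a <= 1 -> q c' <= q c ->
  q (fun k => c k + a * (c' k - c k)) <= q c.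
Proof.
move=> /andP[a0 a1] qcc'.
suff: q (fun k => c k + a * (c' k - c k)) <= (1 - a) * q c + a * q c'.
  move=> /le_trans; apply.
  by rewrite -[leRHS]mul1r -{2}(subrK a 1) [X in _ <= X]mulrDl lerD2l ler_wpM2l.
rewrite /sq_residual !mulr_sumr -big_split/=; apply: ler_sum => i _.
have -> : \sum_k (c k + a * (c' k - c k)) * v k i =
    (1 - a) * (\sum_k c k * v k i) + a * (\sum_k c' k * v k i).
  by rewrite !mulr_sumr -big_split/=; apply: eq_bigr => k _; ring.
set s := \sum_k _; set s' := \sum_k _.
rewrite -subr_ge0.
have -> : (1 - a) * (y i - s) ^+ 2 + a * (y i - s') ^+ 2 -
   (y i - ((1 - a) * s + a * s')) ^+ 2 = a * (1 - a) * (s - s') ^+ 2 by ring.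
by rewrite mulr_ge0 ?sqr_ge0// mulr_ge0// subr_ge0.
Qed.

Variable Q : {set K}.

(** Induction on the number of nonzero constrained coordinates of [c]. If the minimizer [c'] on the
    face of [c] is infeasible, moving towards it until a constrained coordinate hits 0 keeps
    feasibility, does not increase [q] and lands on a smaller face. *)
Lemma descent_to_face (c : K -> R) : (forall k, k \in Q -> 0 <= c k) ->
  exists (Z : {set K}) (d : K -> R), [/\ forall k, k \in Q -> 0 <= d k,
    forall k, k \in Z -> d k = 0,
    forall d', (forall k, k \in Z -> d' k = 0) -> q d <= q d' &
    q d <= q c].
Proof.
have [N] := ubnP #|[set k in Q | c k != 0]|.
elim: N c => // N IH c cN cQ.
pose Z := [set k in Q | c k == 0].
have [c' [c'Z c'min]] := least_squares_face Z.
have qc'c : q c' <= q c by apply: c'min => k; rewrite inE => /andP[_ /eqP].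
have [c'Q|] := boolP [forall k in Q, 0 <= c' k].
  by exists Z, c'; split => // k; move/forall_inP: c'Q; apply.
rewrite negb_forall_in => /exists_inP[k1 k1Q]; rewrite -ltNge => c'k1.
pose B := [pred k | (k \in Q) && (c' k < 0)].
have Bk1 : B k1 by rewrite /= k1Q.
have [k0 /andP[k0Q c'k0] k0min] := arg_minP (fun k => c k / (c k - c' k)) Bk1.
(* [c k = 0] would put [k] in [Z] and force [c' k = 0]. *)
have Bgt0 k : B k -> 0 < c k.
  move=> /andP[kQ c'k]; rewrite lt_neqAle cQ// andbT eq_sym.
  by apply: contraTneq c'k => ck0; rewrite c'Z ?ltxx// inE kQ ck0 eqxx.
have ck0 : 0 < c k0 by apply: Bgt0; rewrite /= k0Q.
have dk0 : 0 < c k0 - c' k0 by rewrite subr_gt0 (lt_trans c'k0).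
(* The step at which the first constrained coordinate reaches 0. *)
set a := c k0 / (c k0 - c' k0) in k0min.
have a01 : 0 <= a <= 1.
  rewrite /a divr_ge0 ?(ltW ck0) ?(ltW dk0)//= ler_pdivrMr// mul1r.
  by rewrite lerBrDr gerDl ltW.
pose d k := c k + a * (c' k - c k).
have dQ k : k \in Q -> 0 <= d k.
  move=> kQ; have [c'k|c'k] := ltP (c' k) 0.
    have Bk : B k by rewrite /= kQ.
    have := k0min k Bk; rewrite ler_pdivlMr ?subr_gt0 ?(lt_trans c'k) ?Bgt0//.
    rewrite /d; lra.
  have -> : d k = (1 - a) * c k + a * c' k by rewrite /d; ring.
  by case/andP: a01 => a0 a1; apply: addr_ge0; apply: mulr_ge0; rewrite ?subr_ge0 ?cQ.
(* Old zeros persist because [c'] vanishes on [Z], and [k0] is a new one. *)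
have dN : (#|[set k in Q | d k != 0%R]| < N)%N.
  rewrite -ltnS (leq_trans _ cN)// ltnS proper_card//; apply/properP; split.
    apply/fintype.subsetP => k; rewrite !inE => /andP[kQ]; rewrite kQ/=.
    apply: contraNneq => ck; rewrite /d ck c'Z ?inE ?kQ ?ck ?eqxx//.
    by rewrite subrr mulr0 addr0.
  exists k0; rewrite !inE k0Q/= ?(gt_eqF ck0)//= negbK.
  rewrite /d /a -(opprB (c k0)) mulrN divfK ?subrr//.
  by rewrite gt_eqF.
have [Z' [d' [d'Q d'Z d'min qd'd]]] := IH d dN dQ.
exists Z', d'; split => //.
by rewrite (le_trans qd'd)// sq_residual_segment.
Qed.

(** Descent bounds every feasible value below by the minimum on a face satisfying [P]; among the
    finitely many such faces one has the least minimum. *)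
Lemma nnls_exists : exists c : K -> R, (forall k, k \in Q -> 0 <= c k) /\
  forall c', (forall k, k \in Q -> 0 <= c' k) -> q c <= q c'.
Proof.
have /choice[f fP] := least_squares_face.
(* Minimizers on a face need not be unique, so the chosen [f Z] may be infeasible while another is
   feasible; hence only a feasible point of no larger value is asked for. *)
pose P Z := `[< exists d : K -> R, (forall k, k \in Q -> 0 <= d k) /\
  q d <= q (f Z) >].
have descent c : (forall k, k \in Q -> 0 <= c k) ->
    exists2 Z, P Z & q (f Z) <= q c.
  move=> /descent_to_face[Z [d [dQ dZ dmin qdc]]]; exists Z.
    by apply/asboolP; exists d; split => //; apply: dmin; case: (fP Z).
  by rewrite (le_trans _ qdc)//; apply: (fP Z).2.
have [//|Z0 PZ0 _] := descent (fun=> 0).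
have [Z /asboolP[d [dQ qd]] Zmin] := arg_minP (fun Z => q (f Z)) PZ0.
exists d; split => // c' /descent[Z' PZ' qZ'].
by rewrite (le_trans qd)// (le_trans _ qZ')// Zmin.
Qed.
End Nnls.

Local Open Scope classical_set_scope.
Local Open Scope ring_scope.

(** * Interpolation of ramps, measures on knots *)

(** Induction on the sorted knots: between the first two the weights are barycentric, beyond the
    second they are those of the tail. Repeated values are harmless, since the interval between them
    is empty. Past the last knot all weights are 0, as is the ramp on the left. *)
Lemma ramp_interpolation_path (R : realType) (J : eqType) (val : J -> R)
    (z : J) (s : seq J) :
  path (relpre val <=%R) z s -> uniq (z :: s) ->
  exists w : R -> J -> R,
    [/\ forall j, measurable_fun setT (w^~ j),
        forall t j, 0 <= w t j <= 1 &
        forall t x, val z <= t -> x \in z :: s ->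
          Num.max (val x - t) 0 =
            \sum_(j <- z :: s) w t j * Num.max (val x - val j) 0].
Proof.
elim: s z => [z _ _|v s IH z].
  exists (fun _ _ => 0); split => [j|t j|t x zt]; first exact: measurable_cst.
    by rewrite lexx ler01.
  rewrite inE => /eqP ->; rewrite big_seq1 mul0r.
  by apply/max_idPr; rewrite subr_le0.
rewrite [path _ _ _]/= => /andP[zv vs] /[dup] zvs_uniq /=/andP[zNvs vs_uniq].
have [w [wm w01 wE]] := IH v vs vs_uniq.
(* Barycentric weight of [z] for [t] between [val z] and [val v]; below [val z] all weights default
   to 0. *)
pose l t := (val v - t) / (val v - val z).
pose w' t j : R := if val v <= t then (if j == z then 0 else w t j)
  else if val z <= t then
    (if j == z then l t else if j == v then 1 - l t else 0)
  else 0.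
have l01 t : val z <= t < val v -> 0 <= l t <= 1.
  move=> /andP[zt tv]; have zv' := le_lt_trans zt tv.
  rewrite /l divr_ge0 ?subr_ge0 ?(ltW tv)//=.
  by rewrite ler_pdivrMr ?subr_gt0// mul1r lerB.
have lm : measurable_fun setT l.
  by apply: measurable_funM => //; apply: measurable_funB.
exists w'; split => [j|t j|t x zt xzvs].
- apply: measurable_fun_ifT; first exact: measurable_fun_ler.
    by case: (j == z).
  apply: measurable_fun_ifT; first exact: measurable_fun_ler.
    by case: (j == z); [|case: (j == v) => //; apply: measurable_funB].
  exact: measurable_cst.
- rewrite /w'; have [_|tv] := boolP (val v <= t).
    by case: (j == z); [rewrite lexx ler01|exact: w01].
  have [zt|_] := boolP (val z <= t); last by rewrite lexx ler01.
  have /andP[l0 l1] : 0 <= l t <= 1 by apply: l01; rewrite zt ltNge.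
  case: (j == z); first by rewrite l0.
  by case: (j == v); rewrite ?lexx ?ler01// subr_ge0 l1 gerBl.
have zle j : j \in z :: v :: s -> val z <= val j.
  rewrite inE => /predU1P[->//|jvs].
  have : path (relpre val <=%R) z (v :: s) by rewrite /= zv.
  rewrite path_sortedE; last by move=> a b c; exact: le_trans.
  by move=> /andP[/allP /(_ _ jvs)].
(* At the least knot every ramp vanishes, on both sides. *)
have [->|xz] := eqVneq x z.
  rewrite big_seq big1 => [|j /zle zj].
    by apply/max_idPr; rewrite subr_le0.
  by rewrite (max_idPr _) ?mulr0// subr_le0.
have xvs : x \in v :: s by move: xzvs; rewrite inE (negbTE xz).
have neqz j : j \in v :: s -> (j == z) = false.
  by move=> jvs; apply: contraNF zNvs => /eqP <-.
rewrite big_cons; have [vt|tv] := leP (val v) t.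
  rewrite {1}/w' vt eqxx mul0r add0r wE//.
  by apply: eq_big_seq => j /neqz jz; rewrite /w' vt jz.
(* Now the ramps starting at [t], [val z] and [val v] are all in their linear part at [val x], and
   only [z] and [v] carry weight. *)
have vx : val v <= val x.
  move: xvs; rewrite inE => /predU1P[->//|xs].
  move: vs; rewrite path_sortedE; last by move=> a b c; exact: le_trans.
  by move=> /andP[/allP /(_ _ xs)].
have zv' := le_lt_trans zt tv.
rewrite big_cons big_seq big1 => [|j js].
  rewrite /w' leNgt tv/= zt eqxx neqz ?mem_head// eqxx addr0.
  rewrite !(max_idPl _) ?subr_ge0 ?(le_trans (ltW tv))// ?(le_trans zv)//.
  rewrite /l; field.
  by rewrite subr_eq0 gt_eqF.
have jvs : j \in v :: s by rewrite inE js orbT.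
rewrite /w' leNgt tv/= zt neqz//.
have -> : (j == v) = false.
  by move: vs_uniq => /= /andP[vNs _]; apply: contraNF vNs => /eqP <-.
by rewrite mul0r.
Qed.

Lemma ramp_interpolation (R : realType) (J : finType) (val : J -> R) (j0 : J) :
  exists w : R -> J -> R,
    [/\ forall j, measurable_fun setT (w^~ j),
        forall t j, 0 <= w t j <= 1 &
        forall t x, val j0 <= t ->
          Num.max (val x - t) 0 =
            \sum_j w t j * Num.max (val x - val j) 0].
Proof.
pose s := sort (relpre val <=%R) (enum J).
have ss : sorted (relpre val <=%R) s.
  by apply: sort_sorted => a b; exact: le_total.
have us : uniq s by rewrite sort_uniq enum_uniq.
have ms j : j \in s by rewrite mem_sort mem_enum.
case sE : s ss us (ms j0) => [//|z s'] ss us j0s.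
have [w [wm w01 wE]] := ramp_interpolation_path ss us.
exists w; split => // t x j0t.
have zt : val z <= t.
  apply: le_trans j0t; move: j0s; rewrite inE => /predU1P[->//|j0s].
  move: ss; rewrite /= path_sortedE; last by move=> a b c; exact: le_trans.
  by move=> /andP[/allP /(_ _ j0s)].
rewrite wE// -?sE//.
by rewrite (perm_big (enum J)) ?perm_sort// big_enum.
Qed.

(** * Measurability and elementary properties of hinges *)

Section Knots.
Variables (R : realType) (k : nat).
Notation tupleR := (k.-tuple (measurableTypeR R)).

Lemma measurable_knot_domain : measurable (knot_domain R k : set tupleR).
Proof.
have mcoord (A : set (measurableTypeR R)) : measurable A ->
    measurable [set t : tupleR | forall i, A (tnth t i)].
  move=> mA; have -> : [set t : tupleR | forall i, A (tnth t i)] =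
     \bigcap_(i in [set: 'I_k]) ((@tnth k (measurableTypeR R))^~ i @^-1` A).
    by apply/seteqP; split => [t tA i _|t tA i]; [exact: tA|exact: (tA i I)].
  apply: fin_bigcap_measurable => // i _.
  by rewrite -[X in measurable X]setTI; apply: measurable_tnth.
apply: measurableD.
  have -> : [set t : k.-tuple R | forall i, 0 <= tnth t i < 1] =
    [set t : tupleR | forall i, `[0%R, 1%R[%classic (tnth t i)].
    by apply/seteqP; split=> t /= tA i; have := tA i; rewrite in_itv.
  exact: mcoord.
have -> : [set origin R k] = [set t : tupleR | forall i, [set 0] (tnth t i)].
  apply/seteqP; split=> [t -> i|t t0]/=; first by rewrite tnth_mktuple.
  by apply: eq_from_tnth => i; rewrite t0 tnth_mktuple.
exact: mcoord.
Qed.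

End Knots.

Lemma measurable_hinge (R : realType) d (S : {set 'I_d}) (x : d.-tuple R) :
  measurable_fun (setT : set (#|S|.-tuple (measurableTypeR R)))
    ((fun t => hinge t x) : _ -> measurableTypeR R).
Proof.
apply: measurable_prod => i _; apply: measurable_maxr => //.
by apply: measurable_funB => //; exact: measurable_tnth.
Qed.

Lemma hinge_ge0 (R : realType) d (S : {set 'I_d}) (t : #|S|.-tuple R) x :
  0 <= hinge t x.
Proof. by apply: prodr_ge0 => i _; rewrite le_max lexx orbT. Qed.

(** Lets weight at the origin, which [lattice] excludes, be absorbed into the coefficient of the
    monomial. *)
Lemma hinge_origin (R : realType) d (S : {set 'I_d}) (x : d.-tuple R) :
  cube R d x -> hinge (origin R #|S|) x = monomial S x.
Proof.
move=> x01; rewrite /hinge /monomial [RHS]big_enum_val/=.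
apply: eq_bigr => i _; rewrite tnth_mktuple subr0.
by apply/max_idPl; case/andP: (x01 (enum_val i)).
Qed.

(** * Finitely supported measures and finite sums *)

Section MeasureAddFinite.
Context d (T : measurableType d) (R : realType).
Variables m1 m2 : {finite_measure set T -> \bar R}.

Let fin_num_measure_add : fin_num_fun (measure_add m1 m2).
Proof.
by move=> U mU; rewrite measure_addE fin_numD !fin_num_measure.
Qed.

HB.instance Definition _ := Measure.copy (measure_add m1 m2)
  (measure_add m1 m2 : {measure set T -> \bar R}).
HB.instance Definition _ :=
  Measure_isFinite.Build _ _ _ (measure_add m1 m2) fin_num_measure_add.
End MeasureAddFinite.

Lemma sum_diracs_exists d (T : measurableType d) (R : realType) (D : set T)
    (r : seq T) (c : T -> R) : measurable D -> (forall t, 0 <= c t) ->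
  exists mu : {finite_measure set T -> \bar R},
    forall f : T -> R, measurable_fun setT f -> (forall t, 0 <= f t) ->
      \int[mu]_(t in D) f t = \sum_(t <- r) c t * (\1_D t * f t).
Proof.
move=> mD c0.
(* In the extended reals, additivity in the measure holds for nonnegative functions without
   integrability conditions. *)
suff [mu muE] : exists mu : {finite_measure set T -> \bar R},
    forall f : T -> R, measurable_fun setT f -> (forall t, 0 <= f t) ->
      (\int[mu]_(t in D) (f t)%:E = (\sum_(t <- r) c t * (\1_D t * f t))%:E)%E.
  by exists mu => f mf f0; rewrite /Rintegral muE.
elim: r => [|a r [mu muE]].
  exists mzero => f mf f0.
  by rewrite big_nil integral_measure_zero.
pose ca : {finite_measure set T -> \bar R} :=
  mscale (NngNum (c0 a)) (dirac a : {measure set T -> \bar R}).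
exists (measure_add ca mu) => f mf f0.
have mEf : measurable_fun D (EFin \o f).
  by apply/measurable_EFinP; apply: measurable_funTS.
rewrite ge0_integral_measure_add//; last by move=> t _; rewrite lee_fin.
rewrite muE// ge0_integral_mscale//; last by move=> t _; rewrite lee_fin.
by rewrite integral_dirac// big_cons EFinD !EFinM.
Qed.

(** Collects the weights of all codes [p] of the same lattice point, as the coding of knots is not
    injective. *)
Lemma fsbig_fibers (R : comPzSemiRingType) (P : finType) (T : choiceType) (g : P -> T)
    (L : set T) (a : P -> R) (h : T -> R) : finite_set L ->
  \sum_(t \in L) (\sum_(p | g p == t) a p) * h t =
    \sum_(p | g p \in L) a p * h (g p).
Proof.
move=> finL; rewrite fsbig_finite//.
under eq_bigr do rewrite mulr_suml.
rewrite (exchange_big_dep xpredT)//= [RHS]big_mkcond/=.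
apply: eq_bigr => p _; rewrite big_mkcond/=.
have memE t : (t \in fset_set L) = (t \in L) by rewrite in_fset_set.
case: ifPn => gL.
  rewrite (big_fsetD1 (g p)) ?memE//= eqxx big_seq big1 ?addr0// => t.
  by rewrite !inE eq_sym => /andP[/negbTE -> _].
rewrite big_seq big1// => t; rewrite memE; case: eqP => // <- gL'.
by rewrite gL' in gL.
Qed.

(** * Exchanging measures and lattice weights *)

Section Data.
Variables (R : realType) (d n : nat) (X : 'I_n -> d.-tuple R).
Hypothesis hX : forall i, cube R d (X i).

Section Subset.
Variable S : {set 'I_d}.
Notation k := #|S|.

(* [None] encodes the knot 0 and [Some m] the m-th data point; the encoding need
   not be injective. *)
Definition knot_coord (i : 'I_k) (o : option 'I_n) : R :=
  if o is Some m then tnth (X m) (enum_val i) else 0.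

Definition knot (p : {ffun 'I_k -> option 'I_n}) : k.-tuple R :=
  [tuple knot_coord i (p i) | i < k].

Lemma lattice_knot p : knot p != origin R k -> lattice X S (knot p).
Proof.
move=> p0; split; last by apply/eqP.
move=> i; rewrite tnth_mktuple; case: (p i) => [m|]; last by left.
by right; exists m.
Qed.

Lemma finite_lattice : finite_set (lattice X S).
Proof.
apply: (@sub_finite_set _ _ (range knot)); last exact: finite_image.
move=> t [tX _].
have /choice[f fE] : forall i, exists o, tnth t i = knot_coord i o.
  by move=> i; case: (tX i) => [->|[m ->]]; [exists None|exists (Some m)].
exists [ffun i => f i] => //.
by apply: eq_from_tnth => i; rewrite tnth_mktuple ffunE fE.
Qed.

(** Tensor product of the one-dimensional interpolations: the product over coordinates of sums over
    knots is expanded into a sum over [p]. *)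
Lemma hinge_interpolation :
  exists W : {ffun 'I_k -> option 'I_n} -> k.-tuple R -> R,
    [/\ forall p, measurable_fun setT
          (W p : k.-tuple (measurableTypeR R) -> measurableTypeR R),
        forall p t, 0 <= W p t <= 1 &
        forall t m, (forall i, 0 <= tnth t i) ->
          hinge t (X m) = \sum_p W p t * hinge (knot p) (X m)].
Proof.
have /choice[w wP] := fun i => @ramp_interpolation R _ (knot_coord i) None.
exists (fun p t => \prod_i w i (tnth t i) (p i)); split.
- move=> p; apply: measurable_prod => i _.
  apply: (measurableT_comp (f := (w i)^~ (p i))); last exact: measurable_tnth.
  by case: (wP i).
- move=> p t; apply/andP; split.
    by apply: prodr_ge0 => i _; case: (wP i) => _ /(_ (tnth t i) (p i))/andP[].
  by apply: prodr_ile1 => i _; case: (wP i).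
move=> t m t0; rewrite /hinge.
transitivity (\prod_(i < k) \sum_o w i (tnth t i) o *
    Num.max (tnth (X m) (enum_val i) - knot_coord i o) 0).
  apply: eq_bigr => i _; case: (wP i) => _ _.
  by move=> /(_ (tnth t i) (Some m)) /= -> //.
rewrite bigA_distr_bigA/=; apply: eq_bigr => p _.
by rewrite -big_split/=; apply: eq_bigr => i _; rewrite tnth_mktuple.
Qed.

(** Integrating the interpolation identity gives each code the weight [a p]. The weights do not
    depend on [m], so one choice of [b] and [g] serves all data points. *)
Lemma integral_hinge_data
    (nu : {finite_measure set (k.-tuple (measurableTypeR R)) -> \bar R}) :
  exists (b : R) (g : k.-tuple R -> R), (forall t, 0 <= g t) /\
    forall m, \int[nu]_(t in knot_domain R k) hinge t (X m) =
      b * monomial S (X m) + \sum_(t \in lattice X S) g t * hinge t (X m).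
Proof.
have [W [Wm W01 WE]] := hinge_interpolation.
have mD := @measurable_knot_domain R k.
pose a p := \int[nu]_(t in knot_domain R k) W p t.
have intW p : nu.-integrable (knot_domain R k) (EFin \o W p).
  apply: measurable_bounded_integrable => //.
  - by rewrite ltey_eq fin_num_measure.
  - by apply: measurable_funTS; exact: Wm.
  - exists 1; split => // M M1 t _ /=.
    by case/andP: (W01 p t) => W0 W1; rewrite ger0_norm// (le_trans W1)// ltW.
have a0 p : 0 <= a p.
  by apply: Rintegral_ge0 => t _; case/andP: (W01 p t).
exists (\sum_(p | knot p == origin R k) a p),
  (fun t => \sum_(p | knot p == t) a p); split => [t|m].
  by apply: sumr_ge0 => p _.
rewrite fsbig_fibers; last exact: finite_lattice.
transitivity (\sum_p a p * hinge (knot p) (X m)).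
  transitivity (\int[nu]_(t in knot_domain R k)
      \sum_p hinge (knot p) (X m) * W p t).
    apply: eq_Rintegral => t; rewrite inE => -[t01 _].
    rewrite WE => [|i]; last by case/andP: (t01 i).
    by apply: eq_bigr => p _; rewrite mulrC.
  rewrite /Rintegral.
  under eq_integral do rewrite -sumEFin.
  have intWh p : nu.-integrable (knot_domain R k)
      (fun t => (hinge (knot p) (X m) * W p t)%:E).
    by under eq_fun do rewrite EFinM; apply: integrableZl => //; exact: intW.
  rewrite integral_sum// -sum_fine => [|p _]; last exact: integrable_fin_num.
  by apply: eq_bigr => p _; rewrite mulrC; apply: RintegralZl => //; exact: intW.
rewrite (bigID (fun p => knot p == origin R k))/=; congr (_ + _).
  rewrite mulr_suml; apply: eq_bigr => p /eqP ->.
  by rewrite hinge_origin.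
apply: eq_bigl => p; apply/idP/idP => [/lattice_knot/mem_set//|].
by rewrite inE => -[_ /eqP].
Qed.

Lemma lattice_measure (g : k.-tuple R -> R) :
    (forall t, lattice X S t -> 0 <= g t) ->
  exists nu : {finite_measure set (k.-tuple (measurableTypeR R)) -> \bar R},
    forall x, cube R d x ->
      \int[nu]_(t in knot_domain R k) hinge t x =
        \sum_(t \in lattice X S) g t * hinge t x.
Proof.
move=> g0.
(* The sign of [g] is known on the lattice only; truncation makes the weights nonnegative
   everywhere. *)
pose c (t : k.-tuple (measurableTypeR R)) := Num.max (g t) 0.
have c0 t : 0 <= c t by rewrite le_max lexx orbT.
have [nu nuE] := @sum_diracs_exists _ (k.-tuple (measurableTypeR R)) R
  (knot_domain R k) (fset_set (lattice X S)) c (@measurable_knot_domain R k) c0.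
exists nu => x x01.
rewrite nuE; [|exact: measurable_hinge|by move=> t; exact: hinge_ge0].
rewrite fsbig_finite; last exact: finite_lattice.
apply: eq_big_seq => t; rewrite in_fset_set; last exact: finite_lattice.
rewrite inE => Lt; rewrite /c (max_idPl (g0 t Lt)); congr (_ * _).
(* A lattice point outside the knot domain has a coordinate equal to 1, where
   the hinge vanishes on the cube. *)
have [tD|tD] := pselect (knot_domain R k t).
  by rewrite indicE mem_set// mul1r.
rewrite indicE memNset// mul0r; apply/esym/eqP/prodf_eq0.
have [tX t0] := Lt.
have [i ti] : exists i, ~ (0 <= tnth t i < 1).
  by apply/existsNP => t01; apply: tD; split.
exists i => //; apply/eqP/max_idPr; rewrite subr_le0.
case: (tX i) ti => [-> /negP|[m ->] /negP]; first by rewrite lexx ltr01.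
have /andP[-> _] /= := hX m (enum_val i); rewrite -leNgt; apply: le_trans.
by case/andP: (x01 (enum_val i)).
Qed.

End Subset.
End Data.

(** * The two function classes *)

Section Classes.
Variables (R : realType) (d s n : nat) (X : 'I_n -> d.-tuple R).
Variable y : 'I_n -> R.
Hypothesis hX : forall i, cube R d (X i).

Lemma F_lattice_sub_F_TC : F_lattice s X `<=` F_TC R d s.
Proof.
move=> f [b0 [b [g [g0 fE]]]].
have nuP (S : {set 'I_d}) : exists nu : {finite_measure set
    (#|S|.-tuple (measurableTypeR R)) -> \bar R},
    (1 <= #|S| <= s)%N -> forall x, cube R d x ->
      \int[nu]_(t in knot_domain R #|S|) hinge t x =
        \sum_(t \in lattice X S) g S t * hinge t x.
  have [Ss|nSs] := boolP (1 <= #|S| <= s)%N; last by exists mzero.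
  by have [nu nuE] := lattice_measure hX (g0 S Ss); exists nu.
exists b0, b, (fun S => projT1 (cid (nuP S))) => x x01.
rewrite fE//; congr (_ - _); apply: eq_bigr => S Ss.
by case: (cid (nuP S)) => nu /= ->.
Qed.

(** Each integral becomes a lattice sum plus [c S] times a monomial; as integrals enter with a minus
    sign, the new coefficient is [b S - c S]. *)
Lemma F_TC_interpolated f : F_TC R d s f ->
  exists2 g, F_lattice s X g & forall m, g (X m) = f (X m).
Proof.
move=> [b0 [b [nu fE]]].
have bgP S := cid (integral_hinge_data hX (nu S)).
pose c S := projT1 (bgP S).
pose g S := projT1 (cid (projT2 (bgP S))).
have g0 S t : 0 <= g S t := proj1 (projT2 (cid (projT2 (bgP S)))) t.
have cgE S m : \int[nu S]_(t in knot_domain R #|S|) hinge t (X m) =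
    c S * monomial S (X m) + \sum_(t \in lattice X S) g S t * hinge t (X m).
  exact: (proj2 (projT2 (cid (projT2 (bgP S))))).
exists (fun x => b0
    + \sum_(S : {set 'I_d} | (1 <= #|S| <= s)%N) (b S - c S) * monomial S x
    - \sum_(S : {set 'I_d} | (1 <= #|S| <= s)%N)
        \sum_(t \in lattice X S) g S t * hinge t x).
  by exists b0, (fun S => b S - c S), g; split.
move=> m; rewrite fE// -!addrA; congr (_ + _).
rewrite -!sumrB; apply: eq_bigr => S _.
by rewrite cgE mulrBl opprD addrA.
Qed.

Lemma F_lattice_lse_exists : exists f, is_lse X y (F_lattice s X) f.
Proof.
pose small (S : {set 'I_d}) := (1 <= #|S| <= s)%N.
(* Generators: the constant, the monomials and the hinges at lattice points. The minus sign of the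
   hinges goes into [v], so that the constraint on [Q] is nonnegativity; subsets of inadmissible
   size give zero vectors. *)
pose K := (unit + {set 'I_d} +
  {S : {set 'I_d} & fset_sub_type (fset_set (lattice X S))})%type.
pose v (k : K) (m : 'I_n) : R := match k with
  | inl (inl _) => 1
  | inl (inr A) => if small A then monomial A (X m) else 0
  | inr k => if small (tag k) then - hinge (val (tagged k)) (X m) else 0
  end.
pose Q : {set K} := 
  finset (fun k : K => if k is inr k' then small (tag k') else false).
pose model b0 b (g : forall S : {set 'I_d}, #|S|.-tuple R -> R) x := b0
  + \sum_(S : {set 'I_d} | (1 <= #|S| <= s)%N) b S * monomial S x
  - \sum_(S : {set 'I_d} | (1 <= #|S| <= s)%N)
      \sum_(t \in lattice X S) g S t * hinge t x.
pose coef b0 b (g : forall S : {set 'I_d}, #|S|.-tuple R -> R) (k : K) : R :=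
  match k with
  | inl (inl _) => b0
  | inl (inr A) => b A
  | inr k => g (tag k) (val (tagged k))
  end.
have coefE b0 b g m : \sum_k coef b0 b g k * v k m = model b0 b g (X m).
  rewrite !big_sumType/= /model; congr (_ + _ + _).
  - by rewrite (big_pred1 tt)//= ?mulr1//; case.
  -
by rewrite [RHS]big_mkcond; apply: eq_bigr => S _; rewrite -/(small S);
      case: ifP; rewrite ?mulr0.
  rewrite -sumrN (bigID (fun k => small (tag k)))/= [X in _ + X]big1 => [|k]; last first.
    by move=> /negbTE ->; rewrite mulr0.
  rewrite addr0.
  transitivity (\sum_(S | small S)
      \sum_(t : fset_sub_type (fset_set (lattice X S)))
        g S (val t) * - hinge (val t) (X m)).
    rewrite sig_big_dep/=; apply: eq_big => [k|k ->//].
    by rewrite andbT.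
  apply: eq_bigr => S _; rewrite fsbig_finite; last exact: finite_lattice.
  rewrite [in RHS]big_seq_fsetE/= -sumrN.
  by apply: eq_bigr => t _; rewrite mulrN.
(* Hinge coefficients are extended by 0 off the lattice. *)
have modelE c : exists b0 b g, c =1 coef b0 b g /\
    ((forall k, k \in Q -> 0 <= c k) -> forall S, small S -> forall t, 0 <= g S t).
  exists (c (inl (inl tt))), (fun S => c (inl (inr S))),
    (fun S t => if insub t is Some t'
      then c (inr (Tagged (fun S => fset_sub_type (fset_set (lattice X S))) t'))
      else 0).
  split=> [[[[]|A]|[A t]]//=|c0 S Ss t]; first by rewrite valK.
  by case: insubP => //= t' _ _; apply: c0; rewrite inE.
have [c [c0 cmin]] := nnls_exists v y Q.
have [b0 [b [g [cE g0]]]] := modelE c.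
have rssE f b0' b' g' : (forall x, cube R d x -> f x = model b0' b' g' x) ->
    rss X y f = sq_residual v y (coef b0' b' g').
  by move=> fE; apply: eq_bigr => m _; rewrite coefE fE.
exists (model b0 b g); split.
  by exists b0, b, g; split => // S Ss t _; exact: g0.
move=> f [b0' [b' [g' [g'0 fE]]]].
rewrite (rssE _ b0 b g)// (rssE _ _ _ _ fE) -(funext cE); apply: cmin.
move=> [[[]|A]|[A t]]; rewrite inE//= => As; apply: g'0 => //.
by have := valP t; rewrite in_fset_set ?inE//; exact: finite_lattice.
Qed.

End Classes.

Theorem proposition5 (R : realType) (d s n : nat) (hd : (1 <= d)%N)
    (hs : (1 <= s <= d)%N) (X : 'I_n -> d.-tuple R) (y : 'I_n -> R)
    (hX : forall i, cube R d (X i)) :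
  (exists f, is_lse X y (F_TC R d s) f) /\
  (exists f, is_lse X y (F_lattice s X) f) /\
  (forall f, is_lse X y (F_lattice s X) f -> is_lse X y (F_TC R d s) f).
Proof.
have lse_TC f : is_lse X y (F_lattice s X) f -> is_lse X y (F_TC R d s) f.
  move=> [fL fmin]; split; first exact: (F_lattice_sub_F_TC hX).
  (* The residual sum sees only values at the data, so [g] may be replaced by [h] from the lattice
     class. *)
  move=> g /(F_TC_interpolated hX)[h hL hg].
  by rewrite (le_trans (fmin h hL))// /rss; under eq_bigr do rewrite hg.
have [f fL] : exists f, is_lse X y (F_lattice s X) f.
  exact: F_lattice_lse_exists.
by split; [exists f; exact: lse_TC|split => //; exists f].
Qed.
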